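(* For every $n\in\mathbb N_0$ and every $b\in\{1,\dots,q\}$, the $n$-th entry $B^{(b)}_n(z)$ of the $b$-th column of $B(z)$ satisfies $$\deg^+B_n^{(b)}\le\left\lceil\frac{n+2-b}{2q}\right\rceil-1,\qquad \deg^-B_n^{(b)}\le\left\lceil\frac{n+2-b-q}{2q}\right\rceil,$$ and, for $N\in\mathbb N_0$, the $\deg^+$ bound is attained for $n=2Nq+b-1$ and the $\deg^-$ bound is attained for $n=(2N+1)q+b-1$. Similarly, for every $n\in\mathbb N_0$ and every $a\in\{1,\dots,p\}$, the $n$-th entry $A^{(a)}_n(z)$ of the $a$-th row of $A(z)$ satisfies $$\deg^+A_n^{(a)}\le\left\lceil\frac{n+2-a}{2p}\right\rceil-1,\qquad \deg^-A_n^{(a)}\le\left\lceil\frac{n+2-a-p}{2p}\right\rceil,$$ and, for $N\in\mathbb N_0$, the $\deg^+$ bound is attained for $n=2Np+a-1$ and the $\deg^-$ bound is attained for $n=(2N+1)p+a-1$.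
   Context: Let $p,q\in\mathbb N$ and let $\mu=(\mu_{b,a})$ be a $q\times p$ matrix of complex Borel measures with infinite support on the unit circle $\mathbb T=\{|z|=1\}$. Rows and columns of semi-infinite matrices are indexed from $0$. For $r\in\mathbb N$, $Z_{[r]}(z)$ is the $\infty\times r$ matrix obtained by stacking the $r\times r$ blocks $I_r, z^{-1}I_r, zI_r, z^{-2}I_r, z^2I_r,\dots$ (block number $2N$ is $z^NI_r$, block number $2N+1$ is $z^{-N-1}I_r$, $N\in\mathbb N_0$). The moment matrix is $M=\oint_{\mathbb T}Z_{[q]}(z)\,\mathrm d\mu(z)\,Z_{[p]}^\top(z^{-1})$. It is assumed that $M$ has a Gauss--Borel factorization $M=L^{-1}\bar U^{-1}$ with $L$ lower triangular and $U$ upper triangular semi-infinite matrices with nonzero diagonal entries (bar = entrywise complex conjugation). Put $B(z)=LZ_{[q]}(z)$ (size $\infty\times q$, entries $B_n^{(b)}(z)$ in row $n$ and column $b$) and $A(z)=Z_{[p]}^\top(z)U$ (size $p\times\infty$, entries $A_n^{(a)}(z)$ in row $a$ and column $n$). Degrees: for a Laurent polynomial $P(z)=\sum_k P_kz^k$, $\deg^+P\le D$ means $P_k=0$ for all $k>D$, and $\deg^-P\le D$ means $P_k=0$ for all $k<-D$; the bound $\deg^+P\le D$ (resp. $\deg^-P\le D$) is attained when $P_D\ne0$ (resp. $P_{-D}\neq0$). *)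

(* Defs.v *)
From HB Require Import structures.
From mathcomp Require Import all_boot all_order all_algebra.
From mathcomp Require Import complex.
From mathcomp Require Import all_classical all_reals all_analysis.

Set Implicit Arguments.
Unset Strict Implicit.
Unset Printing Implicit Defensive.

Import Order.TTheory GRing.Theory Num.Theory.
Import numFieldNormedType.Exports.

Local Open Scope ring_scope.
Local Open Scope complex_scope.
Local Open Scope classical_set_scope.

(** * Complex Borel measures on the unit circle *)

Definition circle_set (R : realType) : set R[i] := [set z | `|z| = 1].

Definition circle (R : realType) : Type := set_type (@circle_set R).

Definition circle_val (R : realType) (z : circle R) : R[i] := set_val z.

Lemma circle1_subproof (R : realType) : (1 : R[i]) \in @circle_set R.
Proof. by rewrite inE /circle_set /= normr1. Qed.

(* The topology is the one induced by R[i]; the base point is only needed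
   because measurable types are pointed. *)
HB.instance Definition _ (R : realType) :=
  Choice.copy (circle R) (set_type (@circle_set R)).
HB.instance Definition _ (R : realType) :=
  Topological.copy (circle R) (initial_topology (@circle_val R : circle R -> (R[i] : numFieldType))).
HB.instance Definition _ (R : realType) :=
  isPointed.Build (circle R) (exist _ (1 : R[i]) (@circle1_subproof R)).

Definition borel_circle (R : realType) : Type :=
  g_sigma_algebraType (@open (circle R)).
HB.instance Definition _ (R : realType) :=
  Measurable.copy (borel_circle R) (g_sigma_algebraType (@open (circle R))).

(* A complex measure nu is given by its real and imaginary parts, which are
   finite signed measures ("charges"): nu = cm_re + i cm_im. *)
Record complex_measure (R : realType) := ComplexMeasure {
  cm_re : {charge set (borel_circle R) -> \bar R} ;
  cm_im : {charge set (borel_circle R) -> \bar R} }.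

Definition cm_val (R : realType) (nu : complex_measure R)
    (A : set (borel_circle R)) : R[i] :=
  fine (cm_re nu A) +i* fine (cm_im nu A).

(* Complement of the union of the open sets on which nu vanishes identically;
   cm_val nu B may be nonzero on a Borel subset B of U although
   cm_val nu U = 0. *)
Definition cm_support (R : realType) (nu : complex_measure R) :
    set (circle R) :=
  [set z | forall U : set (circle R), open U -> U z ->
     exists B : set (borel_circle R),
       [/\ measurable B, B `<=` U & cm_val nu B != 0]].

(* Integral against a signed measure through its Jordan decomposition, which
   does not depend on the choice of the Hahn decomposition (P, N). *)
Definition charge_integral d (T : measurableType d) (R : realType)
    (nu : {charge set T -> \bar R}) (f : T -> R) : R :=
  let PN := cid (Hahn_decomposition nu) in
  let nuPN := svalP (cid (svalP PN)) in
  (\int[jordan_pos nuPN]_x f x - \int[jordan_neg nuPN]_x f x)%R.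

Definition cm_integral (R : realType) (nu : complex_measure R)
    (f : circle R -> R[i]) : R[i] :=
  (charge_integral (cm_re nu) (fun z => complex.Re (f z))
     - charge_integral (cm_im nu) (fun z => complex.Im (f z)))
  +i* (charge_integral (cm_re nu) (fun z => complex.Im (f z))
     + charge_integral (cm_im nu) (fun z => complex.Re (f z))).

(** * Semi-infinite matrices *)

(* The sum is a finite-support sum (and 0 by convention when the support is
   infinite): below, one of the factors is always triangular in such a way
   that only finitely many terms are nonzero. *)
Definition simx_mul (K : pzRingType) (I J : Type)
    (A : I -> nat -> K) (B : nat -> J -> K) : I -> J -> K :=
  fun i j => \sum_(k \in [set: nat]) (A i k * B k j).

Definition simx1 (K : pzRingType) : nat -> nat -> K :=
  fun i j => (i == j)%:R.

Definition lower_tri (K : pzRingType) (A : nat -> nat -> K) : Prop :=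
  forall i j : nat, (i < j)%N -> A i j = 0.

Definition upper_tri (K : pzRingType) (A : nat -> nat -> K) : Prop :=
  forall i j : nat, (j < i)%N -> A i j = 0.

Definition simx_inverse (K : pzRingType) (A B : nat -> nat -> K) : Prop :=
  simx_mul A B = @simx1 K /\ simx_mul B A = @simx1 K.

(* M = L^-1 * (conj U)^-1; Li and Vi are the inverses of L and of conj U in
   the groups of lower and of upper triangular matrices. *)
Definition Gauss_Borel (R : realType) (M L U : nat -> nat -> R[i]) : Prop :=
  [/\ lower_tri L, upper_tri U,
      (forall n, L n n != 0), (forall n, U n n != 0)
    & exists Li Vi : nat -> nat -> R[i],
      [/\ lower_tri Li, upper_tri Vi,
          simx_inverse L Li,
          simx_inverse (fun i j => conjc (U i j)) Vi
        & M = simx_mul Li Vi]].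

(* Exponent of z in the m-th block of Z: m = 2N gives N, and m = 2N+1 gives
   Negz N = -(N+1). *)
Definition Zexp (m : nat) : int := if odd m then Negz m./2 else Posz m./2.

Definition Zmx (K : fieldType) (r : nat) (z : K) : nat -> 'I_r -> K :=
  fun n c => if (n %% r)%N == c then z ^ Zexp (n %/ r) else 0.

Definition moment_matrix (R : realType) (q p : nat)
    (mu : 'M[complex_measure R]_(q, p)) : nat -> nat -> R[i] :=
  fun i j => \sum_(b < q) \sum_(a < p)
    cm_integral (mu b a) (fun z =>
      Zmx (circle_val z) i b * Zmx (circle_val z)^-1 j a).

Definition Bmx (K : fieldType) (q : nat) (L : nat -> nat -> K) (z : K) :
    nat -> 'I_q -> K :=
  simx_mul L (@Zmx K q z).

Definition Amx (K : fieldType) (p : nat) (U : nat -> nat -> K) (z : K) :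
    'I_p -> nat -> K :=
  simx_mul (fun a n => @Zmx K p z n a) U.

(** * Degrees of Laurent polynomials *)

(* f, as a function on K \ {0}, is the Laurent polynomial \sum_k c_k z^k.
   Over an infinite field such as R[i], c is determined by f. *)
Definition laurent_coefs (K : fieldType) (f : K -> K) (c : int -> K) : Prop :=
  finite_set [set k | c k != 0] /\
  forall z : K, z != 0 -> f z = \sum_(k \in [set: int]) (c k * z ^ k).

Definition degp_le (K : fieldType) (f : K -> K) (D : int) : Prop :=
  exists2 c, laurent_coefs f c & forall k : int, D < k -> c k = 0.

Definition degm_le (K : fieldType) (f : K -> K) (D : int) : Prop :=
  exists2 c, laurent_coefs f c & forall k : int, k < - D -> c k = 0.

Definition degp_attained (K : fieldType) (f : K -> K) (D : int) : Prop :=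
  exists2 c, laurent_coefs f c & c D != 0.

Definition degm_attained (K : fieldType) (f : K -> K) (D : int) : Prop :=
  exists2 c, laurent_coefs f c & c (- D) != 0.

(* Bounds for the n-th entry of the c-th column of B or row of A (c
   counted from 1) with blocks of size r; the divisions take place in rat. *)
Definition degp_bound (r n c : nat) : int :=
  Num.ceil ((n%:Q + 2%:Q - c%:Q) / (2%:Q * r%:Q)) - 1.

Definition degm_bound (r n c : nat) : int :=
  Num.ceil ((n%:Q + 2%:Q - c%:Q - r%:Q) / (2%:Q * r%:Q)).

(* Main.v *)
(* The block carrying z^e is unique, so the coefficient of z^e in an entry of B
   or A is a single entry of L or U, whose index grows with |e|; triangularity
   truncates it, and at the stated n the extreme one is a diagonal entry. *)
Require Import Defs.
From mathcomp Require Import all_boot all_order all_algebra.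
From mathcomp Require Import complex.
From mathcomp Require Import all_classical all_reals all_analysis.
From mathcomp Require Import zify.
Import Order.TTheory GRing.Theory Num.Theory.
Local Open Scope ring_scope.
Local Open Scope complex_scope.
Local Open Scope classical_set_scope.

Definition Zblock (e : int) : nat :=
  match e with Posz N => N.*2 | Negz N => N.*2.+1 end.

Lemma ZblockK : cancel Zblock Zexp.
Proof.
by case=> N; rewrite /Zexp /= odd_double /= ?uphalf_double ?doubleK.
Qed.

Lemma ZexpK : cancel Zexp Zblock.
Proof.
move=> m; rewrite -[RHS]odd_double_half /Zexp.
by case: (odd m).
Qed.

(** The only row in which column [c] of [Zmx] carries the power [z ^ e]. *)
Definition Zrow (r c : nat) (e : int) : nat := (Zblock e * r + c)%N.

Lemma Zrow_div (r : nat) (c : 'I_r) (e : int) :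
  (Zrow r c e %/ r)%N = Zblock e.
Proof.
have r0 : (0 < r)%N by apply: leq_ltn_trans (ltn_ord c).
by rewrite /Zrow divnMDl // divn_small ?addn0.
Qed.

Lemma Zrow_mod (r : nat) (c : 'I_r) (e : int) : (Zrow r c e %% r)%N = c.
Proof. by rewrite /Zrow modnMDl modn_small. Qed.

Lemma Zmx_Zrow (K : fieldType) (r : nat) (c : 'I_r) (z : K) (e : int) :
  Zmx z (Zrow r c e) c = z ^ e.
Proof. by rewrite /Zmx Zrow_mod eqxx Zrow_div ZblockK. Qed.

Lemma Zmx_notin_Zrow (K : fieldType) (r : nat) (c : 'I_r) (z : K) (k : nat) :
  ~ range (Zrow r c) k -> Zmx z k c = 0.
Proof.
move=> kn; rewrite /Zmx; case: eqP => // kc; case: kn.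
by exists (Zexp (k %/ r)) => //; rewrite /Zrow ZexpK -kc -divn_eq.
Qed.

(** Column [c] of [Zmx] vanishes off the range of the injection [Zrow r c], so reindexing the sum
    over rows by exponents gives the Laurent expansion. *)
Lemma laurent_coefs_Zmx (K : fieldType) (r n : nat) (c : 'I_r) (l : nat -> K) :
  (forall k, (n < k)%N -> l k = 0) ->
  laurent_coefs (fun z => \sum_(k \in [set: nat]) (l k * Zmx z k c))
    (fun e => l (Zrow r c e)).
Proof.
move=> l0; split.
  (* A nonzero coefficient sits in a row at most [n], and the row determines its exponent. *)
  apply: (@sub_finite_set _ _ ((fun k => Zexp (k %/ r)) @` `I_n.+1)).
    move=> e /= le; exists (Zrow r c e); last by rewrite Zrow_div ZblockK.
    by rewrite /= ltnS leqNgt; apply/negP => /l0 /eqP; apply/negP.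
  exact/finite_image/finite_II.
move=> z _.
rewrite -(@fsbig_widen _ _ _ _ (range (Zrow r c))) //; last first.
  by move=> k [_ kn] /=; rewrite Zmx_notin_Zrow // mulr0.
rewrite (reindex_fsbig (Zrow r c) [set: int]).
  by apply: eq_fsbigr => e _; rewrite Zmx_Zrow.
split; [by move=> e _; exists e | | by []].
move=> e f _ _ ef.
by apply: (can_inj ZblockK); rewrite -(@Zrow_div r c) ef Zrow_div.
Qed.

(** For an integer [k], [ceil x - 1 < k] means [x <= k]; clearing the denominator leaves an integer
    inequality without ceiling. *)
Lemma degp_bound_lt (r n c : nat) (k : int) : (0 < r)%N ->
  (degp_bound r n c < k) = (n%:Z + 2 - c%:Z <= k * (2 * r%:Z)).
Proof.
move=> r0; rewrite /degp_bound ltrBlDr ltzD1 ceil_le_int.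
have r0' : 0 < 2%:Q * r%:Q by rewrite mulr_gt0 // ltr0n.
by rewrite ler_pdivrMr // -!(intrM, intrD, intrB) ler_int.
Qed.

Lemma degm_bound_lt (r n c : nat) (k : int) : (0 < r)%N ->
  (degm_bound r n c < k) = (n%:Z + 2 - c%:Z - r%:Z <= (k - 1) * (2 * r%:Z)).
Proof.
move=> r0; rewrite /degm_bound -[k in LHS](subrK 1) ltzD1 ceil_le_int.
have r0' : 0 < 2%:Q * r%:Q by rewrite mulr_gt0 // ltr0n.
by rewrite ler_pdivrMr // -!(intrM, intrD, intrB) ler_int.
Qed.

(** Here the fraction under the ceiling is [N + 1/(2r)], with ceiling [N + 1]. *)
Lemma degp_bound_Zrow (r N : nat) (c : 'I_r) :
  degp_bound r (Zrow r c N%:Z) c.+1 = N%:Z.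
Proof.
have := ltn_ord c => cr.
have r0 : (0 < r)%N by lia.
apply/eqP; rewrite eq_le; apply/andP; split.
  by rewrite -ltzD1 degp_bound_lt // /Zrow /=; nia.
by rewrite leNgt degp_bound_lt // /Zrow /=; nia.
Qed.

Lemma degm_bound_Zrow (r N : nat) (c : 'I_r) :
  degm_bound r (Zrow r c (Negz N)) c.+1 = N.+1%:Z.
Proof.
have := ltn_ord c => cr.
have r0 : (0 < r)%N by lia.
apply/eqP; rewrite eq_le; apply/andP; split.
  by rewrite -ltzD1 degm_bound_lt // /Zrow /=; nia.
by rewrite leNgt degm_bound_lt // /Zrow /=; nia.
Qed.

(** The hypothesis reads [n + 1 - c <= 2re]. Since [c < r], this excludes negative [e]; otherwise
    [2re + c] is the row itself. *)
Lemma Zrow_gt_degp (r n : nat) (c : 'I_r) (e : int) :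
  degp_bound r n c.+1 < e -> (n < Zrow r c e)%N.
Proof.
have := ltn_ord c => cr.
rewrite degp_bound_lt; last by lia.
by case: e => N; rewrite /Zrow /=; nia.
Qed.

(** Now [c < r] excludes [e >= 0], and for [e = -(N+1)] the hypothesis reads
    [n + 1 <= (2N+1)r + c]. *)
Lemma Zrow_gt_degm (r n : nat) (c : 'I_r) (e : int) :
  e < - degm_bound r n c.+1 -> (n < Zrow r c e)%N.
Proof.
have := ltn_ord c => cr.
rewrite ltrNr degm_bound_lt; last by lia.
by case: e => N; rewrite /Zrow /=; nia.
Qed.

(** Common to both halves of the theorem: [l] will be [L] for [B] and the transpose of [U] for
    [A]. *)
Lemma degrees_Zmx (K : fieldType) (r : nat) (c : 'I_r) (l : nat -> nat -> K) :
  lower_tri l -> (forall n, l n n != 0) ->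
  let f n z := \sum_(k \in [set: nat]) (l n k * Zmx z k c) in
  [/\ forall n : nat, degp_le (f n) (degp_bound r n c.+1),
      forall n : nat, degm_le (f n) (degm_bound r n c.+1),
      forall N n : nat, n = (2 * N * r + c.+1 - 1)%N ->
        degp_attained (f n) (degp_bound r n c.+1)
    & forall N n : nat, n = ((2 * N + 1) * r + c.+1 - 1)%N ->
        degm_attained (f n) (degm_bound r n c.+1)].
Proof.
move=> l_tri l_diag f.
have fc n := @laurent_coefs_Zmx K r n c (l n) (l_tri n).
split=> [n|n|N n nE|N n nE].
- by eexists; [exact: fc | move=> e /Zrow_gt_degp; exact: l_tri].
- by eexists; [exact: fc | move=> e /Zrow_gt_degm; exact: l_tri].
(* The coefficient of [z ^ N] becomes the diagonal entry [l n n]. *)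
- have -> : n = Zrow r c N%:Z by rewrite nE /Zrow /=; lia.
  by eexists; [exact: fc | rewrite degp_bound_Zrow].
- have -> : n = Zrow r c (Negz N) by rewrite nE /Zrow /=; lia.
  by eexists; [exact: fc | rewrite degm_bound_Zrow].
Qed.

(* Columns of B and rows of A are indexed from 0: b and a stand for the
   paper's b - 1 and a - 1. *)
Theorem lemma2p7 (R : realType) (p q : nat) (hp : (0 < p)%N) (hq : (0 < q)%N)
    (mu : 'M[complex_measure R]_(q, p))
    (hmu : forall (b : 'I_q) (a : 'I_p), infinite_set (cm_support (mu b a)))
    (L U : nat -> nat -> R[i])
    (hLU : Gauss_Borel (moment_matrix mu) L U) :
  (forall b : 'I_q,
     let B (n : nat) (z : R[i]) : R[i] := Bmx L z n b in
     [/\ forall n : nat, degp_le (B n) (degp_bound q n b.+1),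
         forall n : nat, degm_le (B n) (degm_bound q n b.+1),
         forall N n : nat, n = (2 * N * q + b.+1 - 1)%N ->
           degp_attained (B n) (degp_bound q n b.+1)
       & forall N n : nat, n = ((2 * N + 1) * q + b.+1 - 1)%N ->
           degm_attained (B n) (degm_bound q n b.+1)]) /\
  (forall a : 'I_p,
     let A (n : nat) (z : R[i]) : R[i] := Amx U z a n in
     [/\ forall n : nat, degp_le (A n) (degp_bound p n a.+1),
         forall n : nat, degm_le (A n) (degm_bound p n a.+1),
         forall N n : nat, n = (2 * N * p + a.+1 - 1)%N ->
           degp_attained (A n) (degp_bound p n a.+1)
       & forall N n : nat, n = ((2 * N + 1) * p + a.+1 - 1)%N ->
           degm_attained (A n) (degm_bound p n a.+1)]).
Proof.
have [L_tri U_tri L_diag U_diag _] := hLU.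
split=> [b|a]; first exact: degrees_Zmx.
(* Commuting the factors turns row [a] of [A] into the transpose of [U] applied to column [a] of
   [Zmx]. *)
have -> : (fun n z => Amx U z a n) =
    (fun n z => \sum_(k \in [set: nat]) (U k n * Zmx z k a)).
  apply/funext => n; apply/funext => z.
  by apply: eq_fsbigr => k _; rewrite mulrC.
apply: (@degrees_Zmx _ _ _ (fun n k => U k n)) => // n k; exact: U_tri.
Qed.
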